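(* Let $N\ge2$ and let $x$ be a point in the interior of $C_N^B=\{x\in\mathbb R^N: x_1\ge\dots\ge x_N\ge0\}$. For $k\ge1/2$ let $(X_{t,(0,k)})_{t\ge0}$ be the Bessel process of type $B_N$ with multiplicity $(k_1,k_2)=(0,k)$ starting at $\sqrt k\, x$, realized from the Bessel process of type $D_N$ as described in the context, with the same $N$-dimensional Brownian motion $(B_t)_{t\ge0}$ for all $k$. Let $\phi(t,x)$ be the solution of the deterministic ODE of type $D_N$ with start in $x$ (see context), and let $(W_t)_{t\ge0}$ be the unique solution of $$dW_t^i=dB_t^i+\sum_{j\ne i}\left(\frac{W_t^j-W_t^i}{(\phi_i(t,x)-\phi_j(t,x))^2}-\frac{W_t^j+W_t^i}{(\phi_i(t,x)+\phi_j(t,x))^2}\right)dt\quad(i=1,\dots,N),\qquad W_0=0,$$ with the same Brownian motion. Then, for every $t>0$, $$\sup_{0\le s\le t,\ k\ge 1/2}\sqrt k\cdot\bigl\|X_{s,(0,k)}-\sqrt k\,\phi(s,x)-W_s\bigr\|<\infty\quad\text{almost surely}.$$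
   Context: Let $C_N^D=\{x\in\mathbb R^N:x_1\ge\dots\ge x_{N-1}\ge|x_N|\}$. The Bessel process $(X^D_{t,k})_{t\ge0}$ of type $D_N$ with multiplicity $k$ is the $C_N^D$-valued continuous (strong) solution of $$dX_{t,k}^{D,i}=dB_t^i+k\sum_{j\ne i}\left(\frac{1}{X_{t,k}^{D,i}-X_{t,k}^{D,j}}+\frac{1}{X_{t,k}^{D,i}+X_{t,k}^{D,j}}\right)dt\qquad(i=1,\dots,N),$$ where $(B_t)_{t\ge0}$ is an $N$-dimensional Brownian motion (the same for all $k$). Convention on versions: there is an event of probability one on which, for all $k\ge1/2$ simultaneously, the path $t\mapsto X^D_{t,k}$ is continuous with values in $C_N^D$, lies in the interior for Lebesgue-almost every time, has locally integrable drift, and satisfies the integrated form of the SDE for all $t\ge0$. The Bessel process of type $B_N$ with multiplicity $(0,k)$ starting at $\sqrt k\,x$ (a diffusion on $C_N^B$ with reflecting boundary) is realized as $$X_{t,(0,k)}=\bigl(X^{D,1}_{t,k},\dots,X^{D,N-1}_{t,k},|X^{D,N}_{t,k}|\bigr),$$ where $X^D_{0,k}=\sqrt k\,x$. For $x$ in the interior of $C_N^D$, $t\mapsto\phi(t,x)$, $t\ge0$, denotes the unique solution, which stays in the interior of $C_N^D$, of $$\frac{d}{dt}\phi_i(t,x)=\sum_{j\ne i}\left(\frac{1}{\phi_i(t,x)-\phi_j(t,x)}+\frac{1}{\phi_i(t,x)+\phi_j(t,x)}\right)\quad(i=1,\dots,N),\qquad\phi(0,x)=x.$$ If $x$ is in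 the interior of $C_N^B$, then so is $\phi(t,x)$ for all $t\ge0$. $\|\cdot\|$ is the Euclidean norm. *)

(* Defs.v *)
From HB Require Import structures.
From mathcomp Require Import all_boot all_order all_algebra.
From mathcomp Require Import all_classical all_reals all_analysis.
Set Implicit Arguments.
Unset Strict Implicit.
Unset Printing Implicit Defensive.
Import Order.TTheory GRing.Theory Num.Theory numFieldNormedType.Exports.
Local Open Scope classical_set_scope.
Local Open Scope ring_scope.

(* Points of R^N are row vectors, and the coordinate x_i (1 <= i <= N) is
   x 0 i with i : 'I_N shifted by one.  Time is a real number; processes are
   only ever constrained at times t >= 0. *)

(* The library norm on 'rV[R]_N is the sup norm. *)
Definition euclidean_norm (R : realType) (N : nat) (x : 'rV[R]_N) : R :=
  Num.sqrt (\sum_i x 0 i ^+ 2).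

Definition abs_last (R : realType) (N : nat) (x : 'rV[R]_N) : 'rV[R]_N :=
  \row_i (if i.+1 == N then `|x 0 i| else x 0 i).

(* C_N^B : x_1 >= ... >= x_N >= 0 *)
Definition chamberB (R : realType) (N : nat) : set 'rV[R]_N :=
  [set x | (forall i j : 'I_N, j = i.+1 :> nat -> x 0 j <= x 0 i) /\
           (forall i : 'I_N, i.+1 = N -> 0 <= x 0 i)].

(* C_N^D : x_1 >= ... >= x_(N-1) >= |x_N|  (for N >= 2) *)
Definition chamberD (R : realType) (N : nat) : set 'rV[R]_N :=
  [set x | forall i j : 'I_N, j = i.+1 :> nat ->
             abs_last x 0 j <= x 0 i].

Definition driftD (R : realType) (N : nat) (x : 'rV[R]_N) : 'rV[R]_N :=
  \row_i \sum_(j | j != i)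
    ((x 0 i - x 0 j)^-1 + (x 0 i + x 0 j)^-1).

(* f'(t) = l for a function f on [0, +oo[ : one-sided at t = 0, two-sided at
   t > 0. *)
Definition has_derivative_nneg (R : realType) (f : R -> R) (t l : R) : Prop :=
  h^-1 * (f (t + h) - f t)
    @[h --> within [set h | 0 <= t + h] (0 : R)^'] --> l.

Definition odeD_solution (R : realType) (N : nat) (x : 'rV[R]_N)
    (phi : R -> 'rV[R]_N) : Prop :=
  [/\ phi 0 = x,
      forall t, 0 <= t -> (@chamberD R N)° (phi t)
    & forall t i, 0 <= t ->
        has_derivative_nneg (fun s => phi s 0 i) t (driftD (phi t) 0 i)].

(* Independence of a finite family of real random variables.  Taking some of
   the A i equal to setT gives the product rule for the subfamilies. *)
Definition mutually_independent d (T : measurableType d) (R : realType)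
    (P : probability T R) (I : finType) (Y : I -> T -> R) : Prop :=
  forall A : I -> set R, (forall i, measurable (A i)) ->
    P (\bigcap_(i in [set: I]) (Y i @^-1` A i)) =
    (\prod_i P (Y i @^-1` A i))%E.

(* N-dimensional standard Brownian motion: the increments over disjoint
   intervals and along different coordinates are independent.  The second
   parameter of normal_prob is the standard deviation. *)
Definition brownian_motion d (T : measurableType d) (R : realType)
    (P : probability T R) (N : nat) (B : R -> T -> 'rV[R]_N) : Prop :=
  [/\ forall t i, 0 <= t -> measurable_fun [set: T] (fun w => B t w 0 i),
      {ae P, forall w, B 0 w = 0},
      forall (n : nat) (s : nat -> R), 0 <= s 0%N ->
        (forall m, (m < n)%N -> s m < s m.+1) ->
        mutually_independent P
          (fun (p : 'I_n * 'I_N) w =>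
             B (s p.1.+1) w 0 p.2 - B (s p.1) w 0 p.2),
      forall s t i (A : set R), 0 <= s -> s < t -> measurable A ->
        P ((fun w => B t w 0 i - B s w 0 i) @^-1` A) =
        normal_prob 0 (Num.sqrt (t - s)) A
    & {ae P, forall w, {within `[0, +oo[, continuous (fun t => B t w)}}].

(* sigma(B_s : 0 <= s <= t), completed with the P-negligible sets. *)
Definition brownian_filtration d (T : measurableType d) (R : realType)
    (P : probability T R) (N : nat) (B : R -> T -> 'rV[R]_N) (t : R) :
    set (set T) :=
  [set A | exists2 C : set T,
     <<s [set D | exists (s : R) (i : 'I_N) (U : set R),
            [/\ 0 <= s, s <= t, measurable U &
                D = (fun w => B s w 0 i) @^-1` U]] >> C &
     P.-negligible ((A `\` C) `|` (C `\` A))].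

Definition brownian_adapted d (T : measurableType d) (R : realType)
    (P : probability T R) (N : nat) (B X : R -> T -> 'rV[R]_N) : Prop :=
  forall t i (U : set R), 0 <= t -> measurable U ->
    brownian_filtration P B t ((fun w => X t w 0 i) @^-1` U).

(* Integrated form, along one path, of dX_t = dB_t + f(t, X_t) dt, X_0 = x0. *)
Definition sde_path (R : realType) (N : nat) (f : R -> 'rV[R]_N -> 'rV[R]_N)
    (x0 : 'rV[R]_N) (b x : R -> 'rV[R]_N) : Prop :=
  [/\ {within `[0, +oo[, continuous x},
      x 0 = x0,
      forall t i, 0 <= t ->
        (@lebesgue_measure R).-integrable `[0, t]
          (fun s => (f s (x s) 0 i)%:E)
    & forall t i, 0 <= t ->
        x t 0 i = x0 0 i + (b t 0 i - b 0 0 i) +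
          (\int[@lebesgue_measure R]_(s in `[0%R, t]) (f s (x s) 0 i))%R].

(* The inverse being total, driftD also has a value on the walls of the
   chamber, but the path spends no time there. *)
Definition besselD_path (R : realType) (N : nat) (k : R) (x0 : 'rV[R]_N)
    (b x : R -> 'rV[R]_N) : Prop :=
  [/\ forall t, 0 <= t -> @chamberD R N (x t),
      {ae @lebesgue_measure R, forall t, 0 <= t ->
         (@chamberD R N)° (x t)}
    & sde_path (fun _ y => k *: driftD y) x0 b x].

(* The Bessel processes of type D_N for all multiplicities k >= 1/2, driven by
   the same B, in versions that solve the equation simultaneously for all k on
   a single almost sure event; x0 k is the start of X k. *)
Definition besselD_family d (T : measurableType d) (R : realType)
    (P : probability T R) (N : nat) (B : R -> T -> 'rV[R]_N)
    (x0 : R -> 'rV[R]_N) (X : R -> R -> T -> 'rV[R]_N) : Prop :=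
  (forall k, 2^-1 <= k -> brownian_adapted P B (X k)) /\
  {ae P, forall w, forall k, 2^-1 <= k ->
     besselD_path k (x0 k) (fun t => B t w) (fun t => X k t w)}.

(* The Bessel process of type B_N with multiplicity (0, k), from that of type
   D_N with multiplicity k. *)
Definition besselB0 (T : Type) (R : realType) (N : nat)
    (XD : R -> R -> T -> 'rV[R]_N) (k t : R) (w : T) : 'rV[R]_N :=
  abs_last (XD k t w).

Definition limit_drift (R : realType) (N : nat) (phi : R -> 'rV[R]_N)
    (t : R) (y : 'rV[R]_N) : 'rV[R]_N :=
  \row_i \sum_(j | j != i)
    ((y 0 j - y 0 i) / (phi t 0 i - phi t 0 j) ^+ 2
     - (y 0 j + y 0 i) / (phi t 0 i + phi t 0 j) ^+ 2).

Definition limit_process d (T : measurableType d) (R : realType)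
    (P : probability T R) (N : nat) (B : R -> T -> 'rV[R]_N)
    (phi : R -> 'rV[R]_N) (W : R -> T -> 'rV[R]_N) : Prop :=
  brownian_adapted P B W /\
  {ae P, forall w,
     sde_path (limit_drift phi) 0 (fun t => B t w) (fun t => W t w)}.

(* Main.v *)
Require Import Defs.
From mathcomp Require Import all_boot all_order all_algebra.
From mathcomp Require Import all_classical all_reals all_analysis.
From mathcomp Require Import measurable_realfun ring lra zify.
Import Order.TTheory GRing.Theory Num.Theory numFieldNormedType.Exports.
Local Open Scope classical_set_scope.
Local Open Scope ring_scope.
Set Implicit Arguments.
Unset Strict Implicit.

(* Everything happens along one path of [B].  Put [psi = sqrt k phi + W] and
   [Z = X_k - psi]: both terms carry the same noise, so [Z] is absolutely
   continuous.  The drift of type D is the gradient of a concave function on the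
   open chamber, hence monotone, and as soon as [psi] lies in the chamber,
   [|Z|^2] grows at most like [2 |Z|] times the defect of [psi] in the equation
   of [X_k].  By a second order expansion this defect is [O(k^(-1/2))], uniformly
   on [[0, t]], because [phi] stays away from the walls.  Since also [phi_N > 0],
   the absolute value in the last coordinate can only decrease the distance.
   This settles all large [k]; for bounded [k] it suffices that the paths are
   bounded, which follows by comparing with [l x + B] for a large constant [l]. *)

(** * Monotonicity from local comparisons, and real-valued Lebesgue integrals *)

Section Aux.
Context {R : realType}.
Implicit Types (f g H : R -> R).
Notation mu := (@lebesgue_measure R).

(** Continuous induction: the supremum of the times [s] with [H s <= H 0] is again such a time, and
    the local comparison around it would reach further if it were smaller than [t]. *)
Lemma locally_nonincreasing_le H (t : R) : 0 <= t ->
  (forall p, 0 <= p <= t -> exists2 d, 0 < d & forall u v,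
     0 <= u -> u <= v -> v <= t -> `|u - p| < d -> `|v - p| < d ->
     H v <= H u) ->
  H t <= H 0.
Proof.
move=> t0 Hloc.
pose S := [set s | 0 <= s <= t /\ H s <= H 0].
have S0 : S 0 by split; rewrite ?lexx.
have ubS : ubound S t by move=> s [/andP[]].
have hsS : has_sup S by split; [exists 0|exists t].
have m0 : 0 <= sup S by apply: ub_le_sup => //; exists t.
have mt : sup S <= t by apply: ge_sup => //; exists 0.
have [d d0 Hd] := Hloc (sup S) (introT andP (conj m0 mt)).
have [s [/andP[s0 st] Hs] ms] := sup_adherent d0 hsS.
have sm : s <= sup S by apply: ub_le_sup; [exists t|split=> //; apply/andP].
have sd : `|s - sup S| < d by rewrite ler0_norm ?subr_le0//; lra.
have Hm : H (sup S) <= H 0.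
  by apply: le_trans Hs; apply: Hd => //; rewrite subrr normr0.
pose v := Num.min t (sup S + d / 2).
have mv : sup S <= v by rewrite le_min mt /=; lra.
have vt : v <= t by rewrite ge_min lexx.
have vd : v <= sup S + d / 2 by rewrite ge_min lexx orbT.
have Sv : S v.
  split; first by rewrite vt (le_trans m0).
  apply: le_trans Hm; apply: Hd => //; rewrite ?subrr ?normr0//.
  by rewrite ger0_norm ?subr_ge0//; lra.
have vm : v <= sup S by apply: ub_le_sup => //; exists t.
have : t <= sup S.
  by move: vm; rewrite ge_min => /orP[//|]; lra.
by move=> tm; have <- : sup S = t by apply/le_anti; rewrite mt tm.
Qed.

(** Almost everywhere [f] agrees with its absolute value, whose integral is nonnegative. *)
Lemma Rintegral_ae_ge0 (D : set R) f : measurable D ->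
  mu.-integrable D (EFin \o f) -> {ae mu, forall r, D r -> 0 <= f r} ->
  0 <= \int[mu]_(r in D) f r.
Proof.
move=> mD intf f0.
have mf := measurable_int mu intf.
suff -> : \int[mu]_(r in D) f r = \int[mu]_(r in D) `|f r|.
  by apply: Rintegral_ge0.
congr fine; apply: ae_eq_integral => //.
  by apply/measurable_EFinP/measurableT_comp => //; apply/measurable_EFinP.
apply: filterS f0; first exact: (ae_filter_ringOfSetsType mu).
by move=> r f0 Dr; rewrite /= ger0_norm// f0.
Qed.

Lemma integrable_sumR {I : Type} (r : seq I) (D : set R) (F : I -> R -> R) :
  measurable D -> (forall i, mu.-integrable D (EFin \o F i)) ->
  mu.-integrable D (EFin \o (fun s => \sum_(i <- r) F i s)).
Proof.
move=> mD intF.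
rewrite (_ : _ \o _ = fun s => (\sum_(i <- r) (EFin \o F i) s)%E); last first.
  by apply/funext => s /=; rewrite sumEFin.
exact: integrable_sum.
Qed.

Lemma Rintegral_sum {I : Type} (r : seq I) (D : set R) (F : I -> R -> R) :
  measurable D -> (forall i, mu.-integrable D (EFin \o F i)) ->
  \int[mu]_(s in D) (\sum_(i <- r) F i s) =
  \sum_(i <- r) \int[mu]_(s in D) F i s.
Proof.
move=> mD intF; elim: r => [|i r IH].
  rewrite big_nil; under eq_Rintegral do rewrite big_nil.
  by rewrite Rintegral_cst// mul0r.
rewrite big_cons -IH -RintegralD//; last exact: integrable_sumR.
by apply: eq_Rintegral => s _; rewrite big_cons.
Qed.

Lemma integrable_mulrl (D : set R) f (c : R) : measurable D ->
  mu.-integrable D (EFin \o f) ->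
  mu.-integrable D (EFin \o (fun s => c * f s)).
Proof.
move=> mD intf.
rewrite (_ : _ \o _ = fun s => (c%:E * (EFin \o f) s)%E); last exact/funext.
exact: integrableZl.
Qed.

Lemma integrable_normr (D : set R) f : measurable D ->
  mu.-integrable D (EFin \o f) ->
  mu.-integrable D (EFin \o (fun s => `|f s|)).
Proof. by move=> mD intf; exact: integrable_norm. Qed.

Lemma integrable_constant (a b c : R) :
  mu.-integrable `[a, b] (EFin \o (fun=> c)).
Proof.
apply: continuous_compact_integrable; first exact: segment_compact.
by apply: continuous_subspaceT => s; exact: cst_continuous.
Qed.

Lemma Rintegral_increment (t u v : R) f : mu.-integrable `[0, t] (EFin \o f) ->
  0 <= u -> u <= v -> v <= t ->
  \int[mu]_(s in `[0, v]) f s - \int[mu]_(s in `[0, u]) f s =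
  \int[mu]_(s in `]u, v]) f s.
Proof.
move=> intf u0 uv vt; rewrite Rintegral_itvB//.
by apply: integrableS intf => //; apply: subset_itvl; rewrite bnd_simp.
Qed.
End Aux.

(** * An energy inequality for absolutely continuous paths *)

Section Energy.
Context {R : realType}.
Notation mu := (@lebesgue_measure R).

Lemma within_continuous_modulus (A : set R) {I : finType} (f : I -> R -> R)
    (p e : R) :
  (forall i, {within A, continuous f i}) -> A p -> 0 < e ->
  exists2 d, 0 < d & forall s, A s -> `|s - p| < d ->
    forall i, `|f i s - f i p| < e.
Proof.
move=> cf Ap e0.
have : \forall s \near within A (nbhs p), forall i, `|f i s - f i p| < e.
  apply: filter_forall => i.
  have /subspace_continuousP/(_ p Ap)/cvgrPdist_lt/(_ e e0) := cf i.
  by apply: filterS => s; rewrite distrC.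
rewrite near_withinE => /nbhs_ballP[d /= d0 Hd].
by exists d => // s As sp; apply: Hd => //=; rewrite /ball/= distrC.
Qed.

(** Formally, [|Z|^2] has derivative [2 <Z, G> <= 2 C]. As [G] is merely integrable, no derivative
    is taken: increments of the squares over short intervals are integrals, compared with [2 C] up
    to an error [eta |G|], and then [eta] tends to 0. *)
Lemma sum_sqr_le_of_ae_pairing {I : finType} (Z G : I -> R -> R) (z : I -> R)
    (t C : R) : 0 <= t ->
  (forall i, {within `[0, t], continuous Z i}) ->
  (forall i, mu.-integrable `[0, t] (EFin \o G i)) ->
  (forall i (s : R), 0 <= s <= t ->
     Z i s = z i + \int[mu]_(r in `[0, s]) G i r) ->
  {ae mu, forall r, r \in `[0, t] -> \sum_i Z i r * G i r <= C} ->
  \sum_i Z i t ^+ 2 <= \sum_i z i ^+ 2 + 2 * C * t.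
Proof.
move=> t0 cZ iG ZE ZG.
(* The [eta] term pays for replacing [Z i u + Z i v] by [2 * Z i r] below. *)
pose g (eta r : R) : R := 2 * C + eta * \sum_i `|G i r|.
have iabs : mu.-integrable `[0, t] (EFin \o (fun r => \sum_i `|G i r|)).
  by apply: integrable_sumR => // i; apply: integrable_normr.
have ig eta : mu.-integrable `[0, t] (EFin \o g eta).
  apply: (@integrableD _ _ _ mu _ _ (EFin \o (fun=> 2 * C))
    (EFin \o (fun r => eta * \sum_i `|G i r|))) => //.
    exact: integrable_constant.
  exact: integrable_mulrl.
have step (eta : R) : 0 < eta ->
    \sum_i Z i t ^+ 2 <= \sum_i z i ^+ 2 + \int[mu]_(r in `[0, t]) g eta r.
  move=> eta0.
  pose H s := \sum_i Z i s ^+ 2 - \int[mu]_(r in `[0, s]) g eta r.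
  suff : H t <= H 0.
    rewrite /H set_itv1 Rintegral_set1 subr0 lerBlDr => /le_trans; apply.
    rewrite lerD2r le_eqVlt; apply/predU1P; left; apply: eq_bigr => i _.
    by rewrite ZE ?lexx// set_itv1 Rintegral_set1 addr0.
  apply: locally_nonincreasing_le => // p pt.
  (* With [Z i u], [Z i v] and [Z i r] all within [eta / 4] of [Z i p], the error [c i - 2 * Z i r]
     stays below [eta]. *)
  have [d d0 Hd] := within_continuous_modulus cZ
    (pt : `[0, t]%classic p) (divr_gt0 eta0 (ltr0n R 4)).
  exists d => // u v u0 uv vt ud vd.
  have ut : u <= t by apply: le_trans vt.
  have v0 : 0 <= v by apply: le_trans uv.
  have sub : `]u, v]%classic `<=` `[0, t]%classic.
    by apply: subset_itv; rewrite bnd_simp.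
  pose c i := Z i u + Z i v.
  have iGuv i : mu.-integrable `]u, v] (EFin \o G i).
    exact: integrableS (iG i).
  have icG : mu.-integrable `]u, v] (EFin \o (fun r => \sum_i c i * G i r)).
    by apply: integrable_sumR => // i; apply: integrable_mulrl.
  have iguv : mu.-integrable `]u, v] (EFin \o g eta).
    exact: integrableS (ig eta).
  (* Each difference of squares is [c i] times the integral of [G i]; this replaces the product
     rule. *)
  have incr : \sum_i Z i v ^+ 2 - \sum_i Z i u ^+ 2 =
      \int[mu]_(r in `]u, v]) \sum_i c i * G i r.
    rewrite Rintegral_sum//; last by move=> i; apply: integrable_mulrl.
    rewrite -sumrB; apply: eq_bigr => i _.
    rewrite RintegralZl// -(Rintegral_increment (iG i))//.
    rewrite /c !ZE ?u0 ?v0//; ring.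
  rewrite -subr_ge0 /H.
  have -> : forall a b c d : R, a - b - (c - d) = (d - b) - (c - a).
    by move=> *; ring.
  rewrite incr (Rintegral_increment (ig eta))// -RintegralB//.
  apply: Rintegral_ae_ge0 => //.
    exact: (@integrableB _ _ _ mu _ _ (EFin \o g eta)
      (EFin \o (fun r => \sum_i c i * G i r))).
  apply: filterS ZG; first exact: (ae_filter_ringOfSetsType mu).
  move=> r ZG /= ruv.
  have rt := sub _ ruv; move: (ruv); rewrite in_itv/= => /andP[ur rv].
  have {}ZG := ZG rt.
  have rd : `|r - p| < d.
    move: ud vd; rewrite !ltr_norml => /andP[? ?] /andP[? ?].
    by apply/andP; split; lra.
  have near_p := Hd; rewrite subr_ge0.
  have -> : \sum_i c i * G i r = 2 * (\sum_i Z i r * G i r) +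
      \sum_i (c i - 2 * Z i r) * G i r.
    by rewrite mulr_sumr -big_split; apply: eq_bigr => i _ /=; ring.
  apply: lerD; first by rewrite ler_pM2l.
  rewrite mulr_sumr; apply: ler_sum => i _.
  apply: le_trans (ler_norm _) _; rewrite normrM ler_wpM2r//.
  have := near_p u _ ud i; have := near_p v _ vd i.
  have := near_p r rt rd i.
  rewrite /= !in_itv/= u0 ut v0 vt /c => /[swap] /(_ isT) + /[swap] /(_ isT).
  rewrite !ltr_norml ler_norml => /andP[? ?] /andP[? ?] /andP[? ?].
  by apply/andP; split; lra.
set A := \int[mu]_(r in `[0, t]) \sum_i `|G i r|.
have A0 : 0 <= A by apply: Rintegral_ge0 => r _; apply: sumr_ge0.
apply/ler_addgt0Pr => e e0.
(* The choice [eta = e / (A + 1)] gives [eta * A <= e]; the added 1 covers [A = 0]. *)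
have eA : 0 < e / (A + 1) by rewrite divr_gt0// ltr_wpDl.
apply: le_trans (step _ eA) _.
rewrite -addrA lerD2l /g RintegralD//; last 2 first.
- exact: integrable_constant.
- exact: integrable_mulrl.
rewrite (RintegralZl _ _ iabs)// -/A Rintegral_cst//.
rewrite [X in 2 * C * X](_ : _ = t); last first.
  rewrite /= lebesgue_measure_itv/= lte_fin.
  by move: t0; rewrite le_eqVlt => /predU1P[<-|->]; rewrite ?ltxx//= oppr0 addr0.
rewrite lerD2l mulrAC ler_pdivrMr ?ltr_wpDl//.
by rewrite ler_pM2l// lerDl.
Qed.
End Energy.

(** * The drift of type D *)

Section Chamber.
Context {R : realType} {N : nat}.
Implicit Types (x y u v w : 'rV[R]_N) (i j : 'I_N) (e : R).

(** Coordinate form of the interior of [chamberD], over all pairs instead of neighbours, so that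
    every root is controlled directly. *)
Definition open_chamber y := forall i j, (i < j)%N -> `|y 0 j| < y 0 i.

(** Equivalently, the roots [y_i - y_j] and [y_i + y_j] with [i < j] are all at least [e]: a
    quantitative distance to the walls. *)
Definition root_gap e y := forall i j, (i < j)%N -> e + `|y 0 j| <= y 0 i.

Lemma root_gap_open e y : 0 < e -> root_gap e y -> open_chamber y.
Proof. by move=> e0 gy i j ij; apply: lt_le_trans (gy _ _ ij); rewrite ltrDr. Qed.

Lemma root_gapD e y w (M : R) : root_gap e y -> (forall i, `|w 0 i| <= M) ->
  root_gap (e - 2 * M) (y + w).
Proof.
move=> gy wM i j ij; rewrite !mxE.
have := gy _ _ ij; have := wM i; have := wM j; have := ler_normD (y 0 j) (w 0 j).
rewrite [`|w 0 i| <= _]ler_norml => ? ? /andP[? ?] ?; lra.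
Qed.

Lemma root_gapZ e y (c : R) : 0 <= c -> root_gap e y -> root_gap (c * e) (c *: y).
Proof.
move=> c0 gy i j ij; rewrite !mxE normrM (ger0_norm c0) -mulrDr.
exact: ler_wpM2l (gy _ _ ij).
Qed.

Lemma root_gap_norm e y i j : root_gap e y -> i != j ->
  e <= `|y 0 i - y 0 j| /\ e <= `|y 0 i + y 0 j|.
Proof.
move=> gy; rewrite -(inj_eq val_inj) neq_ltn => /orP[] ij.
  have := gy _ _ ij; have := ler_norm (y 0 j); have := ler_norm (- y 0 j).
  rewrite normrN; have := ler_norm (y 0 i - y 0 j).
  by have := ler_norm (y 0 i + y 0 j); split; lra.
have := gy _ _ ij; have := ler_norm (y 0 i); have := ler_norm (- y 0 i).
rewrite normrN distrC; have := ler_norm (y 0 j - y 0 i).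
by have := ler_norm (y 0 i + y 0 j); split; lra.
Qed.

Lemma open_chamber_pair u v i j : open_chamber u -> open_chamber v -> i != j ->
  0 < (u 0 i - u 0 j) * (v 0 i - v 0 j) /\
  0 < (u 0 i + u 0 j) * (v 0 i + v 0 j).
Proof.
move=> ou ov; rewrite -(inj_eq val_inj) neq_ltn => /orP[] ij.
  have := ou _ _ ij; have := ov _ _ ij; rewrite !ltr_norml.
  by move=> /andP[? ?] /andP[? ?]; split; apply: mulr_gt0; lra.
have := ou _ _ ij; have := ov _ _ ij; rewrite !ltr_norml.
move=> /andP[? ?] /andP[? ?]; split; last by apply: mulr_gt0; lra.
by rewrite -mulrNN; apply: mulr_gt0; lra.
Qed.

(** [chamberD] relates neighbouring coordinates only, so its inequalities are chained by induction
    on the index distance. *)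
Lemma chamberD_norm_le y i j : chamberD y -> (i < j)%N -> `|y 0 j| <= y 0 i.
Proof.
move=> cy.
have lastE l : l.+1 <> N -> forall h : (l < N)%N,
    abs_last y 0 (Ordinal h) = y 0 (Ordinal h).
  by move=> /eqP/negbTE lN h; rewrite mxE /= lN.
have anti m : forall i j, j = (i + m.+1)%N :> nat -> abs_last y 0 j <= y 0 i.
  elim: m => [|m IH] {}i {}j jE; first by apply: cy; rewrite jE addn1.
  have lN : (i + m.+1 < N)%N by have := ltn_ord j; rewrite jE; lia.
  apply: (@le_trans _ _ (y 0 (Ordinal lN))).
    by apply: cy; rewrite jE /=; lia.
  rewrite -lastE; first by apply: IH.
  by have := ltn_ord j; rewrite jE; lia.
move=> ij; apply: (@le_trans _ _ (abs_last y 0 j)); last first.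
  by apply: (anti (j - i.+1)%N); lia.
(* Before the last index, [y 0 j] is nonnegative because it dominates the absolute value of the last
   coordinate. *)
rewrite mxE; case: eqP => // jN.
have lN : (N.-1 < N)%N by have := ltn_ord j; lia.
rewrite ger0_norm//.
apply: le_trans (anti (N.-1 - j.+1)%N j (Ordinal lN) _).
  by rewrite mxE /= prednK ?eqxx//; lia.
by have := ltn_ord j; rewrite /=; lia.
Qed.

(** Lowering one coordinate slightly stays in [A]; for the closed chambers this turns weak
    inequalities into strict ones. *)
Lemma interior_shift (A : set 'rV[R]_N) y i : A° y ->
  exists2 e, 0 < e & A (y - e *: delta_mx 0 i).
Proof.
move=> /nbhs_ballP[e /= e0 yA]; exists (e / 2); first by rewrite divr_gt0.
apply: yA; split=> // r j; rewrite /ball/= !mxE opprB addrCA subrr addr0 normrM ger0_norm; last by rewrite divr_ge0// ltW.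
by case: (_ && _); rewrite ?normr1 ?normr0; lra.
Qed.

Lemma interior_chamberD y : (@chamberD R N)° y -> open_chamber y.
Proof.
move=> iy i j ij; have [e e0 /chamberD_norm_le/(_ ij)] := interior_shift i iy.
rewrite !mxE !eqxx (gtn_eqF ij : (j == i) = false) /= mulr0 mulr1 subr0.
by move=> /le_lt_trans; apply; rewrite ltrBlDr ltrDl.
Qed.

Lemma interior_chamberB_last y i : (@chamberB R N)° y -> i.+1 = N -> 0 < y 0 i.
Proof.
move=> iy iN; have [e e0 [_ /(_ i iN)]] := interior_shift i iy.
by rewrite !mxE !eqxx mulr1 subr_ge0; apply: lt_le_trans.
Qed.

Lemma subr_mul_subV_le0 (p q : R) : 0 < p * q -> (p - q) * (p^-1 - q^-1) <= 0.
Proof.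
move=> pq; have p0 : p != 0 by apply: contraTneq pq => ->; rewrite mul0r ltxx.
have q0 : q != 0 by apply: contraTneq pq => ->; rewrite mulr0 ltxx.
have -> : (p - q) * (p^-1 - q^-1) = - ((p - q) ^+ 2 / (p * q)) by field; apply/andP.
by rewrite oppr_le0 divr_ge0 ?sqr_ge0// ltW.
Qed.

(* driftD is the gradient of the concave function [sum_(i < j) ln (y_i^2 - y_j^2)]. *)
Lemma driftD_monotone u v : open_chamber u -> open_chamber v ->
  \sum_i (u 0 i - v 0 i) * (driftD u 0 i - driftD v 0 i) <= 0.
Proof.
move=> ou ov.
pose T i j : R := (u 0 i - v 0 i) *
  (((u 0 i - u 0 j)^-1 - (v 0 i - v 0 j)^-1) +
   ((u 0 i + u 0 j)^-1 - (v 0 i + v 0 j)^-1)).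
set S := (X in X <= 0).
have SE : S = \sum_i \sum_(j | j != i) T i j.
  apply: eq_bigr => i _; rewrite !mxE -sumrB mulr_sumr.
  by apply: eq_bigr => j _; rewrite /T; ring.
(* Symmetrization: adding the sum with [i] and [j] exchanged groups the terms by root, and each root
   contributes some [(p - q) * (p^-1 - q^-1) <= 0]. *)
have SE' : S = \sum_i \sum_(j | j != i) T j i.
  rewrite SE (exchange_big_dep xpredT)//=; apply: eq_bigr => i _.
  by apply: eq_bigl => j; rewrite eq_sym.
suff : S + S <= 0 by lra.
rewrite {1}SE SE' -big_split /=; apply: sumr_le0 => i _.
rewrite -big_split /=; apply: sumr_le0 => j ji.
have [/subr_mul_subV_le0 m p] := open_chamber_pair ou ov ji.
have {}p := subr_mul_subV_le0 p.
have -> : T i j + T j i =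
  (u 0 j - u 0 i - (v 0 j - v 0 i)) *
    ((u 0 j - u 0 i)^-1 - (v 0 j - v 0 i)^-1) +
  (u 0 j + u 0 i - (v 0 j + v 0 i)) *
    ((u 0 j + u 0 i)^-1 - (v 0 j + v 0 i)^-1).
  rewrite /T -(opprB (u 0 j)) -(opprB (v 0 j)) !invrN.
  by rewrite (addrC (u 0 i) (u 0 j)) (addrC (v 0 i) (v 0 j)); ring.
by lra.
Qed.

Lemma driftD_bound e y i : 0 < e -> root_gap e y ->
  `|driftD y 0 i| <= 2 * N%:R / e.
Proof.
move=> e0 gy; rewrite mxE; apply: le_trans (ler_norm_sum _ _ _) _.
apply: (@le_trans _ _ (\sum_(j < N) 2 / e)); last first.
  by rewrite sumr_const card_ord -mulr_natr; rewrite le_eqVlt; apply/predU1P; left; ring.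
rewrite big_mkcond; apply: ler_sum => j _; case: ifP => ji; last first.
  by rewrite divr_ge0// ltW.
have [m p] := root_gap_norm gy (ji : j != i).
apply: le_trans (ler_normD _ _) _; rewrite !normfV distrC addrC [y 0 i + _]addrC.
by rewrite mulrDl mul1r; apply: lerD; rewrite lef_pV2 ?posrE//; lra.
Qed.

(** First order Taylor formula for [q / (p + h / q)]. The remainder is exactly
    [h ^+ 2 / (p ^+ 2 * (q * p + h))], and the smallness of [h] keeps the last factor at least
    [q * e / 2] in absolute value. *)
Lemma invr_expansion (q p h e : R) : 0 < q -> 0 < e -> e <= `|p| ->
  2 * `|h| <= q * e ->
  `|q ^+ 2 / (q * p + h) - q / p + h / p ^+ 2| <=
    2 * `|h| ^+ 2 / (e ^+ 3 * q).
Proof.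
move=> q0 e0 ep hq.
have p0 : p != 0 by rewrite -normr_gt0; lra.
have qe0 : 0 < q * e by apply: mulr_gt0.
have low : q * e / 2 <= `|q * p + h|.
  have : `|q * p| <= `|q * p + h| + `|h|.
    by rewrite -{1}(addrK h (q * p)); apply: le_trans (ler_normB _ _) _.
  rewrite normrM gtr0_norm//.
  have : q * e <= q * `|p| by rewrite ler_pM2l.
  by move=> ? ?; lra.
have d0 : q * p + h != 0 by rewrite -normr_gt0; lra.
have -> : q ^+ 2 / (q * p + h) - q / p + h / p ^+ 2 =
    h ^+ 2 / (p ^+ 2 * (q * p + h)) by field; apply/andP.
rewrite normrM normfV [`|p ^+ 2 * _|]normrM !normrX.
have -> : 2 * `|h| ^+ 2 / (e ^+ 3 * q) = `|h| ^+ 2 / (e ^+ 2 * (q * e / 2)).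
  by field; apply/andP; split; apply: lt0r_neq0.
rewrite ler_wpM2l ?exprn_ge0// lef_pV2 ?posrE; last 2 first.
- by rewrite mulr_gt0 ?exprn_gt0 ?normr_gt0.
- by rewrite mulr_gt0 ?exprn_gt0//; lra.
by apply: ler_pM => //; rewrite ?exprn_ge0 ?ler_pXn2r ?nnegrE//; lra.
Qed.

(** [driftD] is homogeneous of degree -1 and [limit_drift phi s] is its linearization at [phi s].
    With [q = sqrt k] the left side is the defect of [q *: phi + w] in the equation of multiplicity
    [k], of order [1 / q]. *)
Lemma driftD_expansion (phi : R -> 'rV[R]_N) (s q e M : R) w i :
  0 < q -> 0 < e -> root_gap e (phi s) -> (forall j, `|w 0 j| <= M) ->
  4 * M <= q * e ->
  `|q * driftD (phi s) 0 i + limit_drift phi s w 0 i -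
    q ^+ 2 * driftD (q *: phi s + w) 0 i| <=
  N%:R * (16 * M ^+ 2 / e ^+ 3) / q.
Proof.
move=> q0 e0 gphi wM Mq; rewrite !mxE distrC.
rewrite !mulr_sumr opprD addrA -!sumrB; apply: le_trans (ler_norm_sum _ _ _) _.
apply: (@le_trans _ _ (\sum_(j < N) 16 * M ^+ 2 / (e ^+ 3 * q))); last first.
  rewrite sumr_const card_ord -mulr_natr le_eqVlt; apply/predU1P; left.
  by field; apply/andP; split; apply: lt0r_neq0.
rewrite big_mkcond; apply: ler_sum => j _; case: ifP => ji; last first.
  by apply: divr_ge0; [rewrite mulr_ge0 ?sqr_ge0|rewrite ltW ?mulr_gt0 ?exprn_gt0].
have [m p] := root_gap_norm gphi (ji : j != i).
rewrite distrC in m; rewrite addrC in p.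
(* The perturbation of a root is [w_i - w_j] or [w_i + w_j], at most [2 * M] in size; each of the
   two roots costs [8 * M ^+ 2], whence the 16. *)
have bd (a b : R) : `|a| <= M -> `|b| <= M -> 2 * `|a + b| <= q * e /\
    2 * `|a + b| ^+ 2 / (e ^+ 3 * q) <= 8 * M ^+ 2 / (e ^+ 3 * q).
  move=> aM bM; have abM : `|a + b| <= 2 * M.
    by apply: le_trans (ler_normD _ _) _; lra.
  split; first by lra.
  rewrite ler_pM2r ?invr_gt0 ?mulr_gt0 ?exprn_gt0//.
  have -> : 8 * M ^+ 2 = 2 * (2 * M) ^+ 2 by ring.
  rewrite ler_pM2l// ler_pXn2r ?nnegrE//.
  by apply: le_trans abM.
have wNM : `|- w 0 j| <= M by rewrite normrN.
have [h1 h1'] := bd _ _ (wM i) wNM; have [h2 h2'] := bd _ _ (wM i) (wM j).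
have := le_trans (invr_expansion q0 e0 m h1) h1'.
have := le_trans (invr_expansion q0 e0 p h2) h2'.
rewrite !mxE.
set a := (X in `|X| <= _) => ab.
set b := (X in `|X| <= _) => bb.
set c := (X in `|X| <= _).
have -> : c = a + b.
  rewrite /a /b /c.
  have -> : q * phi s 0 i + w 0 i - (q * phi s 0 j + w 0 j) =
    q * (phi s 0 i - phi s 0 j) + (w 0 i - w 0 j) by ring.
  have -> : q * phi s 0 i + w 0 i + (q * phi s 0 j + w 0 j) =
    q * (phi s 0 i + phi s 0 j) + (w 0 i + w 0 j) by ring.
  by ring.
apply: le_trans (ler_normD _ _) _.
have -> : 16 * M ^+ 2 / (e ^+ 3 * q) =
  8 * M ^+ 2 / (e ^+ 3 * q) + 8 * M ^+ 2 / (e ^+ 3 * q) by ring.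
exact: lerD.
Qed.

End Chamber.

(** * Comparison of paths driven by the same noise *)

Section Comparison.
Context {R : realType}.
Notation mu := (@lebesgue_measure R).

Lemma within_continuous_coord (N : nat) (A : set R) (x : R -> 'rV[R]_N) i :
  {within A, continuous x} -> {within A, continuous (fun s => x s 0 i)}.
Proof.
move=> cx s; apply: (@continuous_comp _ _ _ (x : subspace A -> _)
  (fun y : 'rV[R]_N => y 0 i)); first exact: cx.
exact: coord_continuous.
Qed.

Lemma within_continuous_sum {I : Type} (r : seq I) (P : pred I) (A : set R)
    (f : I -> R -> R) : (forall i, P i -> {within A, continuous f i}) ->
  {within A, continuous (fun s => \sum_(i <- r | P i) f i s)}.
Proof.
move=> cf; apply/subspace_continuousP => s As.
apply: cvg_big => [|i Pi]; first exact: add_continuous.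
by have /subspace_continuousP := cf i Pi; apply.
Qed.

Lemma within_continuousM (A : set R) (f g : R -> R) :
  {within A, continuous f} -> {within A, continuous g} ->
  {within A, continuous (fun s => f s * g s)}.
Proof. by move=> cf cg s; apply: cvgM; [exact: cf|exact: cg]. Qed.

Lemma within_continuous_upper {I : finType} (f : I -> R -> R) (t : R) :
  0 <= t -> (forall i, {within `[0, t], continuous f i}) ->
  exists2 M, 0 < M & forall i (s : R), 0 <= s <= t -> f i s <= M.
Proof.
move=> t0 cf.
have /choice[m Hm] : forall i, exists m : R, 0 <= m /\
    forall s, 0 <= s <= t -> f i s <= m.
  move=> i; have [c _ Hc] := EVT_max t0 (cf i).
  exists `|f i c|; split=> // s st; apply: le_trans (ler_norm _).
  by apply: Hc; rewrite in_itv.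
(* The sum dominates every [m i]; the 1 keeps the bound positive even for an empty family. *)
exists (1 + \sum_i m i).
  by rewrite ltr_wpDr// sumr_ge0// => i _; have [] := Hm i.
move=> i s st; have [_ /(_ _ st) le] := Hm i.
apply: le_trans le _; rewrite (bigD1 i)//= addrCA lerDl addr_ge0// sumr_ge0//.
by move=> j _; have [] := Hm j.
Qed.

Lemma within_continuous_normr (A : set R) (f : R -> R) :
  {within A, continuous f} -> {within A, continuous (fun s => `|f s|)}.
Proof.
move=> cf s; apply: (@continuous_comp _ _ _ (f : subspace A -> _)
  (fun y : R => `|y|)); [exact: cf|exact: norm_continuous].
Qed.

Lemma within_continuous_bounded {I : finType} (f : I -> R -> R) (t : R) :
  0 <= t -> (forall i, {within `[0, t], continuous f i}) ->
  exists2 M, 0 < M & forall i (s : R), 0 <= s <= t -> `|f i s| <= M.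
Proof.
move=> t0 cf; apply: (within_continuous_upper (f := fun i s => `|f i s|) t0).
by move=> i; apply: within_continuous_normr.
Qed.

(** The reciprocals are continuous too, hence have a common upper bound. *)
Lemma within_continuous_lower {I : finType} (f : I -> R -> R) (t : R) :
  0 <= t -> (forall i, {within `[0, t], continuous f i}) ->
  (forall i (s : R), 0 <= s <= t -> 0 < f i s) ->
  exists2 e, 0 < e & forall i (s : R), 0 <= s <= t -> e <= f i s.
Proof.
move=> t0 cf f0.
have [|M M0 HM] := @within_continuous_upper I (fun i s => (f i s)^-1) t t0.
  move=> i; apply/subspace_continuousP => s st; apply: cvgV.
    by apply: lt0r_neq0; apply: f0; rewrite /= in_itv in st.
  by have /subspace_continuousP := cf i; apply.
exists M^-1; first by rewrite invr_gt0.
move=> i s st; rewrite -[leRHS]invrK lef_pV2 ?posrE ?invr_gt0 ?f0//.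
exact: HM.
Qed.

Lemma euclidean_norm_ge0 (N : nat) (y : 'rV[R]_N) : 0 <= euclidean_norm y.
Proof. exact: sqrtr_ge0. Qed.

Lemma sqr_euclidean_norm (N : nat) (y : 'rV[R]_N) :
  euclidean_norm y ^+ 2 = \sum_i y 0 i ^+ 2.
Proof. by rewrite sqr_sqrtr// sumr_ge0// => i _; rewrite sqr_ge0. Qed.

Lemma le_euclidean_norm (N : nat) (y z : 'rV[R]_N) :
  (forall i, `|y 0 i| <= `|z 0 i|) -> euclidean_norm y <= euclidean_norm z.
Proof.
move=> yz; rewrite /euclidean_norm ler_wsqrtr//; apply: ler_sum => i _.
by rewrite -[leLHS]real_normK ?num_real// -[leRHS]real_normK ?num_real//
  ler_pXn2r ?nnegrE.
Qed.

Lemma coord_le_euclidean_norm (N : nat) (y : 'rV[R]_N) i :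
  `|y 0 i| <= euclidean_norm y.
Proof.
rewrite -(@ler_pXn2r _ 2) ?nnegrE ?euclidean_norm_ge0//.
rewrite sqr_euclidean_norm real_normK ?num_real// (bigD1 i)//= lerDl.
by apply: sumr_ge0 => j _; exact: sqr_ge0.
Qed.

Lemma euclidean_norm_le_sum (N : nat) (y : 'rV[R]_N) (M : R) : 0 <= M ->
  (forall i, `|y 0 i| <= M) -> euclidean_norm y <= N%:R * M.
Proof.
move=> M0 yM; rewrite -(@ler_pXn2r _ 2) ?nnegrE ?euclidean_norm_ge0 ?mulr_ge0//.
rewrite sqr_euclidean_norm; apply: (@le_trans _ _ (\sum_(i < N) M ^+ 2)).
  apply: ler_sum => i _; rewrite -[leLHS]real_normK ?num_real//.
  by rewrite ler_pXn2r ?nnegrE.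
rewrite sumr_const card_ord -[leLHS]mulr_natl exprMn ler_wpM2r ?sqr_ge0//.
by rewrite -natrX ler_nat; case: (N) => // n; rewrite leq_pmulr.
Qed.

(** If [m > a + c], then [m * m > m * a + m * c >= a ^+ 2 + c * m]. This resolves an energy bound in
    which the maximum occurs on both sides. *)
Lemma quadratic_bound (m a c : R) : 0 <= m -> 0 <= a -> 0 <= c ->
  m ^+ 2 <= a ^+ 2 + c * m -> m <= a + c.
Proof.
move=> m0 a0 c0 H; rewrite leNgt; apply/negP => lt.
have am : a <= m by lra.
have : m * (a + c) < m * m by rewrite ltr_pM2l//; lra.
by have : a * a <= a * m; [rewrite ler_wpM2l|]; move: H; rewrite !expr2; lra.
Qed.

(* The difference of two paths driven by the same noise is noise-free, and
   monotonicity of the drift makes it grow at most at the rate of the defect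
   of [psi] in the equation. *)
Lemma besselD_comparison (N : nat) (k K t : R) (x0 psi0 : 'rV[R]_N)
    (b x psi g : R -> 'rV[R]_N) :
  0 <= k -> 0 <= K -> 0 <= t ->
  sde_path (fun _ y => k *: driftD y) x0 b x ->
  {ae mu, forall s, 0 <= s -> (@chamberD R N)° (x s)} ->
  (forall i, {within `[0, t], continuous (fun s => psi s 0 i)}) ->
  (forall i, mu.-integrable `[0, t] (EFin \o (fun s => g s 0 i))) ->
  (forall i (s : R), 0 <= s <= t -> psi s 0 i =
     psi0 0 i + (b s 0 i - b 0 0 i) + \int[mu]_(r in `[0, s]) g r 0 i) ->
  (forall s : R, 0 <= s <= t -> open_chamber (psi s)) ->
  (forall i (s : R), 0 <= s <= t ->
     `|g s 0 i - k * driftD (psi s) 0 i| <= K) ->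
  forall s : R, 0 <= s <= t -> euclidean_norm (x s - psi s) <=
    euclidean_norm (x0 - psi0) + 2 * K * N%:R * t.
Proof.
move=> k0 K0 t0 [cx _ ix xE] xint cpsi ig psiE psio gK.
pose Z i s := x s 0 i - psi s 0 i.
pose G i s := (k *: driftD (x s)) 0 i - g s 0 i.
have cZ i : {within `[0, t], continuous Z i}.
  apply: within_continuousB; last exact: cpsi.
  apply: continuous_subspaceW (within_continuous_coord cx).
  by move=> s /=; rewrite !in_itv/= => /andP[->].
have iG i : mu.-integrable `[0, t] (EFin \o G i).
  apply: (@integrableB _ _ _ mu _ _
    (EFin \o (fun s => (k *: driftD (x s)) 0 i))
    (EFin \o (fun s => g s 0 i))) => //.
  exact: ix.
have ZE i (s : R) : 0 <= s <= t ->
    Z i s = (x0 - psi0) 0 i + \int[mu]_(r in `[0, s]) G i r.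
  move=> /andP[s0 st]; rewrite /Z /G RintegralB//; last 2 first.
  - exact: ix.
  - apply: integrableS (ig i) => //; apply: subset_itvl; exact: st.
  by rewrite xE// psiE ?s0// !mxE; ring.
have cS : {within `[0, t], continuous (fun s => \sum_i Z i s ^+ 2)}.
  by apply: within_continuous_sum => i _; apply: within_continuousM; exact: cZ.
have normZ s : euclidean_norm (x s - psi s) ^+ 2 = \sum_i Z i s ^+ 2.
  by rewrite sqr_euclidean_norm; apply: eq_bigr => i _; rewrite !mxE.
(* The energy inequality is applied up to the time [c] where the distance is largest, so that its
   maximum [M] bounds the coordinates of [Z] in the pairing. *)
have [c /=] := EVT_max t0 cS; rewrite in_itv/= => /andP[c0 ct] maxc.
set M := euclidean_norm (x c - psi c).
have leM (s : R) : 0 <= s <= t -> euclidean_norm (x s - psi s) <= M.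
  move=> st; rewrite -(@ler_pXn2r _ 2) ?nnegrE ?euclidean_norm_ge0//.
  by rewrite !normZ; apply: maxc; rewrite in_itv.
have M0 : 0 <= M by apply: euclidean_norm_ge0.
have energy : M ^+ 2 <= euclidean_norm (x0 - psi0) ^+ 2 +
    2 * (N%:R * (M * K)) * c.
  have sub : `[0, c]%classic `<=` `[0, t]%classic.
    by apply: subset_itvl; rewrite bnd_simp.
  rewrite normZ sqr_euclidean_norm.
  apply: (sum_sqr_le_of_ae_pairing (G := G) c0) => [i|i|i s /andP[s0 sc]|].
  - exact: continuous_subspaceW sub (cZ i).
  - exact: integrableS (iG i).
  - by apply: ZE; rewrite s0 (le_trans sc).
  (* The path of [x] may touch the walls, but only at a null set of times, which the almost
     everywhere pairing tolerates. *)
  apply: filterS xint; first exact: (ae_filter_ringOfSetsType mu).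
  move=> r xr /sub /=; rewrite in_itv/= => rt; have /andP[r0 _] := rt.
  have := driftD_monotone (interior_chamberD (xr r0)) (psio r rt).
  set D := (X in X <= 0) => D0.
  (* Inserting [k * driftD (psi r)] splits the pairing into a monotone part [k * D <= 0] and the
     defect of [psi]. *)
  have -> : \sum_i Z i r * G i r =
      k * D + \sum_i Z i r * (k * driftD (psi r) 0 i - g r 0 i).
    by rewrite mulr_sumr -big_split; apply: eq_bigr => i _; rewrite /Z /G mxE /=; ring.
  have kD : k * D <= 0 by rewrite mulr_ge0_le0.
  apply: ler_wnDl => //.
  apply: (@le_trans _ _ (\sum_(i < N) M * K)); last first.
    by rewrite sumr_const card_ord -[leLHS]mulr_natl.
  apply: ler_sum => i _; apply: le_trans (ler_norm _) _; rewrite normrM.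
  apply: ler_pM => //; last by rewrite distrC gK.
  apply: le_trans (leM r rt); have := coord_le_euclidean_norm (x r - psi r) i.
  by rewrite !mxE.
move=> s st; apply: le_trans (leM s st) _.
apply: quadratic_bound => //; first exact: euclidean_norm_ge0.
  by rewrite !mulr_ge0.
apply: le_trans energy _; rewrite lerD2l.
have -> : 2 * K * N%:R * t * M = 2 * (N%:R * (M * K)) * t by ring.
by rewrite ler_wpM2l// !mulr_ge0.
Qed.
End Comparison.

(** * The deterministic flow *)

Section Ode.
Context {R : realType}.
Notation mu := (@lebesgue_measure R).

(** The increment is [h] times the difference quotient, hence tends to 0; the point [s] itself is
    outside the punctured filter and is treated apart. *)
Lemma has_derivative_nneg_cvg (f : R -> R) (s l : R) : 0 <= s ->
  has_derivative_nneg f s l -> f @ within `[0, +oo[ (nbhs s) --> f s.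
Proof.
move=> s0 fl; apply/cvgrPdist_lt => e e0.
have h0 : h @[h --> within [set h | 0 <= s + h] (0 : R)^'] --> (0 : R).
  apply: cvg_within_filter; apply: cvg_within_filter; exact: cvg_id.
have hfl : h * (h^-1 * (f (s + h) - f s))
    @[h --> within [set h | 0 <= s + h] (0 : R)^'] --> (0 : R).
  by rewrite -[X in _ --> X](mul0r l); apply: cvgM.
move/cvgrPdist_lt : hfl => /(_ e e0).
rewrite !near_withinE => /nbhs_ballP[d /= d0 Hd].
apply/nbhs_ballP; exists d => // u /= su; rewrite in_itv/= andbT => u0.
have [->|us] := eqVneq u s; first by rewrite subrr normr0.
have us0 : u - s != 0 by rewrite subr_eq0.
have := Hd (u - s); rewrite /ball/= !sub0r !normrN (_ : s + (u - s) = u); last by ring.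
rewrite mulrA divff// mul1r [`|f s - _|]distrC [`|u - s|]distrC; apply => //.
Qed.

Lemma has_derivative_nneg_is_derive (f : R -> R) (s l : R) : 0 < s ->
  has_derivative_nneg f s l -> is_derive s 1 f l.
Proof.
move=> s0 fl.
have fl' : h^-1 *: (f (h *: 1 + s) - f s) @[h --> (0 : R)^'] --> l.
  apply/cvgrPdist_lt => e e0; move/cvgrPdist_lt : fl => /(_ e e0).
  rewrite !near_withinE => /nbhs_ballP[d /= d0 Hd].
  (* For [|h| < s] the constraint [0 <= s + h] holds automatically, so the derivative is
     two-sided. *)
  apply/nbhs_ballP; exists (Num.min d s); first by rewrite /= lt_min d0.
  move=> h; rewrite /ball/= sub0r normrN lt_min => /andP[hd hs] h0.
  rewrite [h *: 1]mulr1 (addrC h); apply: Hd => //=; first by rewrite /ball/= sub0r normrN.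
  by move: hs; rewrite ltr_norml => /andP[? _]; lra.
by split; [apply/cvg_ex; exists l|apply: cvg_lim].
Qed.

Lemma within_derive_nneg_le (f df : R -> R) (t : R) :
  (forall s, 0 <= s <= t -> has_derivative_nneg f s (df s)) ->
  {within `[0, t], continuous f}.
Proof.
move=> fdf; apply/subspace_continuousP => s /=; rewrite in_itv/= => st.
have /andP[s0 _] := st.
apply: cvg_trans (has_derivative_nneg_cvg s0 (fdf s st)).
apply: cvg_app; apply: within_subset => u /=.
by rewrite !in_itv/= => /andP[->].
Qed.

Lemma Rintegral_has_derivative_nneg (f df : R -> R) (t : R) :
  0 <= t -> (forall s, 0 <= s <= t -> has_derivative_nneg f s (df s)) ->
  {within `[0, t], continuous df} ->
  f t = f 0 + \int[mu]_(s in `[0, t]) df s.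
Proof.
rewrite le_eqVlt => /predU1P[<- _ _|t0 fdf cdf].
  by rewrite set_itv1 Rintegral_set1 addr0.
have dff s : s \in `]0, t[ -> is_derive s 1 f (df s).
  rewrite in_itv/= => /andP[s0 st]; apply: has_derivative_nneg_is_derive => //.
  by apply: fdf; rewrite !ltW.
have [_ cf0 cft] := (continuous_within_itvP f t0).1 (within_derive_nneg_le fdf).
rewrite /Rintegral (@continuous_FTC2 _ df f)//=; first by ring.
  by split=> // s /dff [].
by move=> s /dff [_ <-]; rewrite derive1E.
Qed.

End Ode.

(** * The type D flow: distance to the walls, integral form, sign of the last coordinate *)

Section OdeD.
Context {R : realType} {N : nat} (x : 'rV[R]_N) (phi : R -> 'rV[R]_N).
Hypothesis hphi : odeD_solution x phi.
Notation mu := (@lebesgue_measure R).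

Lemma odeD_continuous (t : R) i :
  {within `[0, t], continuous (fun s => phi s 0 i)}.
Proof.
have [_ _ dphi] := hphi.
apply: (within_derive_nneg_le (df := fun s => driftD (phi s) 0 i)).
by move=> s /andP[s0 _]; apply: dphi.
Qed.

Lemma odeD_open (s : R) : 0 <= s -> open_chamber (phi s).
Proof. by have [_ iphi _] := hphi => s0; exact/interior_chamberD/iphi. Qed.

Lemma odeD_gap (t : R) : 0 <= t -> exists2 e, 0 < e &
  forall s : R, 0 <= s <= t -> root_gap e (phi s).
Proof.
move=> t0.
(* The dummy value 1 makes [f] positive on every pair, so one compactness argument covers the whole
   finite family. *)
pose f (p : 'I_N * 'I_N) s : R :=
  if (p.1 < p.2)%N then phi s 0 p.1 - `|phi s 0 p.2| else 1.
have cf p : {within `[0, t], continuous f p}.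
  rewrite /f; case: (p.1 < p.2)%N.
    apply: within_continuousB; first exact: odeD_continuous.
    by apply: within_continuous_normr; exact: odeD_continuous.
  by apply: continuous_subspaceT => s; exact: cst_continuous.
have f0 p (s : R) : 0 <= s <= t -> 0 < f p s.
  move=> /andP[s0 _]; rewrite /f; case: ifP => // ij.
  by rewrite subr_gt0; exact: odeD_open.
have [e e0 He] := within_continuous_lower t0 cf f0.
exists e => // s st i j ij.
by have := He (i, j) s st; rewrite /f /= ij lerBrDr.
Qed.

Lemma driftD_odeD_continuous (t : R) i :
  {within `[0, t], continuous (fun s => driftD (phi s) 0 i)}.
Proof.
rewrite (_ : (fun s => _) = fun s => \sum_(j | j != i)
    ((phi s 0 i - phi s 0 j)^-1 + (phi s 0 i + phi s 0 j)^-1)); last first.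
  by apply/funext => s; rewrite mxE.
apply: within_continuous_sum => j ji.
apply/subspace_continuousP => s /=; rewrite in_itv/= => st.
have /andP[s0 _] := st.
have cphi l : phi s' 0 l @[s' --> within `[0, t] (nbhs s)] --> phi s 0 l.
  have /subspace_continuousP := @odeD_continuous t l; apply.
  by rewrite /= in_itv.
have [m p] := open_chamber_pair (odeD_open s0) (odeD_open s0) ji.
have mN : phi s 0 i - phi s 0 j != 0.
  by rewrite -oppr_eq0 opprB; apply: contraTneq m => ->; rewrite mul0r ltxx.
have pN : phi s 0 i + phi s 0 j != 0.
  by rewrite addrC; apply: contraTneq p => ->; rewrite mul0r ltxx.
by apply: cvgD; apply: cvgV => //; [apply: cvgB|apply: cvgD]; exact: cphi.
Qed.

Lemma odeD_integral (t : R) i : 0 <= t ->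
  phi t 0 i = x 0 i + \int[mu]_(s in `[0, t]) driftD (phi s) 0 i.
Proof.
have [phi0 _ dphi] := hphi => t0; rewrite -[in x 0 i]phi0.
apply: (Rintegral_has_derivative_nneg (f := fun s => phi s 0 i)) => //.
  by move=> s /andP[s0 _]; exact: dphi.
exact: driftD_odeD_continuous.
Qed.

(* [phi_N' = - a phi_N] with [a] bounded on compacts, so [phi_N ^+ 2] decays at
   most exponentially and [phi_N] has no zero. *)
Lemma odeD_last_gt0 (t : R) i : 0 < x 0 i -> 0 <= t -> 0 < phi t 0 i.
Proof.
move=> xi t0; have [phi0 _ dphi] := hphi.
have [e e0 He] := odeD_gap t0.
(* For each [j], with [a] and [b] the two roots, [2 * phi_i * (a^-1 + b^-1) = 4 * phi_i ^+ 2 / (a *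
   b)] since [a + b = 2 * phi_i], and [|a * b| >= e ^+ 2]; there are at most [N] such terms. *)
pose c : R := 4 * N%:R / e ^+ 2.
have drift_le (s : R) : 0 <= s <= t ->
    0 <= 2 * phi s 0 i * driftD (phi s) 0 i + c * phi s 0 i ^+ 2.
  move=> st; have gs := He s st.
  have -> : c * phi s 0 i ^+ 2 = \sum_(j < N) 4 * phi s 0 i ^+ 2 / e ^+ 2.
    by rewrite sumr_const card_ord -[RHS]mulr_natl /c; ring.
  rewrite mxE mulr_sumr big_mkcond -big_split; apply: sumr_ge0 => j _ /=.
  have e2 : 0 < e ^+ 2 by rewrite exprn_gt0.
  case: ifP => ji; last first.
    rewrite add0r; apply: divr_ge0; last exact: sqr_ge0.
    by apply: mulr_ge0 => //; exact: sqr_ge0.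
  have [m p] := root_gap_norm gs (ji : j != i).
  rewrite distrC in m; rewrite addrC in p.
  have m0 : phi s 0 i - phi s 0 j != 0 by rewrite -normr_gt0; lra.
  have p0 : phi s 0 i + phi s 0 j != 0 by rewrite -normr_gt0; lra.
  set a := phi s 0 i - phi s 0 j in m m0 *; set b := phi s 0 i + phi s 0 j in p p0 *.
  have ab : `|(a * b)^-1| <= (e ^+ 2)^-1.
    rewrite normfV normrM expr2 lef_pV2 ?posrE ?mulr_gt0 ?normr_gt0//.
    by apply: ler_pM => //; exact: ltW.
  have abE : phi s 0 i * (a^-1 + b^-1) = 2 * phi s 0 i ^+ 2 * (a * b)^-1.
    have -> : phi s 0 i = (a + b) / 2 by rewrite /a /b; field.
    by field; apply/andP.
  rewrite -mulrA abE; move: ab; rewrite ler_norml => /andP[ab _].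
  have := sqr_ge0 (phi s 0 i) => f0.
  have : 0 <= phi s 0 i ^+ 2 * ((a * b)^-1 + (e ^+ 2)^-1) by rewrite mulr_ge0//; lra.
  lra.
(* Integrating factor: by [drift_le] the function [u] is nondecreasing, so [phi_i] cannot vanish; a
   change of sign is then excluded by the intermediate value theorem. *)
pose u s := phi s 0 i ^+ 2 * expR (c * s).
have u_le (s : R) : 0 <= s <= t -> x 0 i ^+ 2 <= u s.
  move=> /andP[s0 st]; have -> : x 0 i ^+ 2 = u 0.
    by rewrite /u phi0 mulr0 expR0 mulr1.
  have du r : r \in `]0, s[ -> is_derive r 1 u
     ((2 * phi r 0 i * driftD (phi r) 0 i + c * phi r 0 i ^+ 2) * expR (c * r)).
    rewrite in_itv/= => /andP[r0 rs].
    have d1 := has_derivative_nneg_is_derive r0 (dphi r i (ltW r0)).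
    have d2 : is_derive r 1 (fun r => expR (c * r)) (c * expR (c * r)).
      rewrite mulrC; apply: (is_derive1_comp (f := expR) (g := fun r => c * r)).
      by apply: (is_derive_eq (is_deriveZ c (is_derive_id r 1))); rewrite /GRing.scale /= mulr1.
    apply: (is_derive_eq (is_deriveM (is_deriveM d1 d1) d2)).
    by rewrite /GRing.scale /= !fctE; ring.
  have cu : {within `[0, s], continuous u}.
    apply: within_continuousM.
      by apply: within_continuousM; exact: odeD_continuous.
    apply: continuous_subspaceT => r; apply: continuous_comp.
      exact: mulrl_continuous.
    exact: continuous_expR.
  apply: (ger0_derive1_le_cc (f := u) _ _ cu); rewrite ?in_itv/= ?lexx ?s0//.
    by move=> r /du [].
  move=> r rs; have [_ ] := du r rs; rewrite -derive1E => ->.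
  move: rs; rewrite in_itv/= => /andP[r0 rs].
  by rewrite mulr_ge0 ?expR_ge0// drift_le// ltW//= ltW// (lt_le_trans rs).
have ne0 (s : R) : 0 <= s <= t -> phi s 0 i != 0.
  move=> st; apply: contraTneq (u_le s st) => p0.
  by rewrite /u p0 expr0n mul0r -ltNge exprn_gt0.
rewrite ltNge; apply/negP => le0.
have [|z] := IVT t0 (@odeD_continuous t i) (v := 0).
  by rewrite ge_min le0 orbT le_max phi0 ltW.
by rewrite in_itv/= => /ne0/eqP.
Qed.

End OdeD.

(** * The pathwise estimate *)

Section Pathwise.
Context {R : realType} {N : nat} (x : 'rV[R]_N) (phi : R -> 'rV[R]_N).
Hypothesis hphi : odeD_solution x phi.
Hypothesis xB : (@chamberB R N)° x.
Variables (b W : R -> 'rV[R]_N) (X : R -> R -> 'rV[R]_N) (t : R).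
Hypothesis cb : {within `[0, +oo[, continuous b}.
Hypothesis hX : forall k, 2^-1 <= k -> besselD_path k (Num.sqrt k *: x) b (X k).
Hypothesis hW : sde_path (limit_drift phi) 0 b W.
Hypothesis t0 : 0 <= t.
Notation mu := (@lebesgue_measure R).

Let sub_t : `[0, t]%classic `<=` `[0, +oo[%classic.
Proof. by move=> s /=; rewrite !in_itv/= => /andP[->]. Qed.

Let cW i : {within `[0, t], continuous (fun s => W s 0 i)}.
Proof.
by have [+ _ _ _] := hW => /within_continuous_coord/(continuous_subspaceW sub_t).
Qed.

Let cbb i : {within `[0, t], continuous (fun s => b s 0 i - b 0 0 i)}.
Proof.
apply: within_continuousB; last by apply: continuous_subspaceT => s; exact: cst_continuous.
exact: continuous_subspaceW sub_t (within_continuous_coord cb).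
Qed.

(** Where the absolute value acts, [z] equals its own absolute value, and the reverse triangle
    inequality applies. *)
Lemma abs_last_sub_le (y z : 'rV[R]_N) : (forall i : 'I_N, i.+1 = N -> 0 <= z 0 i) ->
  euclidean_norm (abs_last y - z) <= euclidean_norm (y - z).
Proof.
move=> z0; apply: le_euclidean_norm => i; rewrite !mxE; case: eqP => // iN.
by rewrite -{1}(ger0_norm (z0 i iN)) ler_dist_dist.
Qed.

Lemma norm_abs_last (y : 'rV[R]_N) i : `|abs_last y 0 i| = `|y 0 i|.
Proof. by rewrite mxE; case: ifP => // _; rewrite normr_id. Qed.

(** Comparison with [psi = q *: phi + W], which has the same start as [X k]. The defect is of order
    [1 / q], which the factor [q = sqrt k] compensates, leaving a bound free of [k]. *)
Lemma besselB0_large (e M k s : R) : 0 < e -> 0 < M ->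
  (forall s, 0 <= s <= t -> root_gap e (phi s)) ->
  (forall (i : 'I_N) (s : R), 0 <= s <= t -> i.+1 = N -> e <= phi s 0 i) ->
  (forall i (s : R), 0 <= s <= t -> `|W s 0 i| <= M) ->
  2^-1 <= k -> 4 * M <= Num.sqrt k * e -> 0 <= s <= t ->
  Num.sqrt k * euclidean_norm (abs_last (X k s) - Num.sqrt k *: phi s - W s)
  <= 2 * (N%:R * (16 * M ^+ 2 / e ^+ 3)) * N%:R * t.
Proof.
move=> e0 M0 gphi lphi WM k2 Mk st.
have k0 : 0 < k by apply: lt_le_trans k2; rewrite invr_gt0.
set q := Num.sqrt k in Mk *.
have q0 : 0 < q by rewrite sqrtr_gt0.
have kE : k = q ^+ 2 by rewrite sqr_sqrtr// ltW.
have [_ Xint Xsde] := hX k2.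
have [_ _ iW WE] := hW.
have idrift i : mu.-integrable `[0, t] (EFin \o (fun s => driftD (phi s) 0 i)).
  apply: continuous_compact_integrable; first exact: segment_compact.
  exact: (driftD_odeD_continuous hphi).
have gE i : EFin \o (fun s => (q *: driftD (phi s) +
      limit_drift phi s (W s)) 0 i) =
    EFin \o (fun s => q * driftD (phi s) 0 i + limit_drift phi s (W s) 0 i).
  by apply/funext => r /=; rewrite !mxE.
pose psi s := q *: phi s + W s.
have H : forall s, 0 <= s <= t -> euclidean_norm (X k s - psi s) <=
    euclidean_norm (q *: x - q *: x) +
    2 * (N%:R * (16 * M ^+ 2 / e ^+ 3) / q) * N%:R * t.
  apply: (besselD_comparison (g := fun s => q *: driftD (phi s) +
    limit_drift phi s (W s)) _ _ t0 Xsde Xint) => [||i|i|i r rt|r rt|i r rt].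
  - exact: ltW.
  - apply: divr_ge0; last exact: ltW.
    apply: mulr_ge0 => //; apply: divr_ge0; last by rewrite exprn_ge0// ltW.
    by apply: mulr_ge0 => //; exact: sqr_ge0.
  - rewrite (_ : (fun s => _) = fun s => q * phi s 0 i + W s 0 i); last first.
      by apply/funext => r; rewrite !mxE.
    apply: within_continuousD; last exact: cW.
    apply: within_continuousM; last exact: (odeD_continuous hphi).
    by apply: continuous_subspaceT => r; exact: cst_continuous.
  - rewrite gE; apply: (@integrableD _ _ _ mu _ _
      (EFin \o (fun s => q * driftD (phi s) 0 i))
      (EFin \o (fun s => limit_drift phi s (W s) 0 i))) => //.
      exact: integrable_mulrl.
    exact: iW.
  - have /andP[r0 rt'] := rt; rewrite !mxE (odeD_integral hphi i r0) WE//.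
    rewrite (_ : \int[mu]_(r' in `[0, r]) (q *: driftD (phi r') +
        limit_drift phi r' (W r')) 0 i =
      \int[mu]_(r' in `[0, r]) (q * driftD (phi r') 0 i +
        limit_drift phi r' (W r') 0 i)); last first.
      by apply: eq_Rintegral => r' _; rewrite !mxE.
    have idr : mu.-integrable `[0, r] (EFin \o (fun s => driftD (phi s) 0 i)).
      by apply: integrableS (idrift i) => //; apply: subset_itvl; rewrite bnd_simp.
    rewrite RintegralD//; [|exact: integrable_mulrl|exact: iW].
    by rewrite RintegralZl// !mxE; ring.
  (* The gap [q * e] of [q *: phi] loses at most [2 * M] by adding [W], and [4 * M <= q * e]. *)
  - apply: (@root_gap_open _ _ (q * e - 2 * M)); first by lra.
    apply: root_gapD => [|j]; last exact: WM.
    by apply: root_gapZ; [exact: ltW|exact: gphi].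
  - rewrite kE [X in `|X - _|]mxE [X in `|X + _ - _|]mxE.
    exact: (driftD_expansion (s := r) i q0 e0 (gphi r rt) (fun j => WM j r rt) Mk).
have {H} := H s st.
have -> : euclidean_norm (q *: x - q *: x) = 0.
  by rewrite subrr /euclidean_norm big1 ?sqrtr0// => i _; rewrite mxE expr0n.
rewrite add0r => H.
have -> : abs_last (X k s) - q *: phi s - W s = abs_last (X k s) - psi s.
  by rewrite /psi opprD addrA.
apply: le_trans (_ : q * euclidean_norm (X k s - psi s) <= _).
  rewrite ler_pM2l//; apply: abs_last_sub_le => i iN.
  have := WM i s st; rewrite ler_norml !mxE => /andP[? _].
  have : q * e <= q * phi s 0 i by rewrite ler_pM2l// lphi.
  lra.
apply: le_trans (_ : q * (2 * (N%:R * (16 * M ^+ 2 / e ^+ 3) / q) * N%:R * t) <= _).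
  by rewrite ler_pM2l.
rewrite le_eqVlt; apply/predU1P; left; field.
by apply/andP; split; apply: lt0r_neq0.
Qed.

(* For bounded [k] only boundedness of the paths is needed; a large multiple
   of [x] keeps the comparison path [l *: x + b] inside the chamber. *)
Lemma besselD_bounded (q1 : R) : 0 <= q1 ->
  exists2 L, 0 <= L & forall k s i, 2^-1 <= k -> Num.sqrt k <= q1 ->
    0 <= s <= t -> `|X k s 0 i| <= L.
Proof.
move=> q10.
have [e e0 /(_ 0)] := odeD_gap hphi t0; have [-> _ _] := hphi.
rewrite lexx t0 => /(_ isT) gx.
have [Mb Mb0 bM] := within_continuous_bounded t0 cbb.
(* [l] is chosen so that [l *: x], perturbed by at most [Mb] in each coordinate, still has root gap
   1. *)
have [l lE l0] : exists2 l, 1 = l * e - 2 * Mb & 0 < l.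
  exists ((1 + 2 * Mb) / e); first by rewrite mulfVK ?gt_eqF//; ring.
  by rewrite divr_gt0//; lra.
(* The first two terms bound [psi], the third the initial distance, the last the accumulated defect:
   at gap 1 the drift is at most [2 * N%:R] and [k <= q1 ^+ 2]. *)
pose L := l * euclidean_norm x + Mb + (q1 + l) * euclidean_norm x +
  2 * (q1 ^+ 2 * (2 * N%:R)) * N%:R * t.
have x0 := euclidean_norm_ge0 x.
exists L.
  have [l1 M1] := (ltW l0, ltW Mb0).
  by rewrite !addr_ge0 ?mulr_ge0 ?addr_ge0 ?exprn_ge0.
move=> k s i k2 kq st.
have k0 : 0 < k by apply: lt_le_trans k2; rewrite invr_gt0.
have kq2 : k <= q1 ^+ 2.
  by rewrite -(sqr_sqrtr (ltW k0)) ler_pXn2r ?nnegrE ?sqrtr_ge0.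
have [_ Xint Xsde] := hX k2.
pose psi s := l *: x + (b s - b 0).
have H : forall s, 0 <= s <= t -> euclidean_norm (X k s - psi s) <=
    euclidean_norm (Num.sqrt k *: x - l *: x) + 2 * (k * (2 * N%:R)) * N%:R * t.
  have gpsi r : 0 <= r <= t -> root_gap 1 (psi r).
    move=> rt; rewrite lE; apply: root_gapD => [|j]; last by rewrite !mxE bM.
    by apply: root_gapZ => //; exact: ltW.
  (* The comparison path moves by noise alone, so its defect is the whole term
     [k *: driftD (psi r)]. *)
  apply: (besselD_comparison (g := fun=> 0) _ _ t0 Xsde Xint)
    => [||j|j|j r rt|r rt|j r rt].
  - exact: ltW.
  - by rewrite !mulr_ge0// ltW.
  - rewrite (_ : (fun s => _) = fun s => l * x 0 j + (b s 0 j - b 0 0 j)); last first.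
      by apply/funext => r; rewrite !mxE.
    apply: within_continuousD; last exact: cbb.
    by apply: continuous_subspaceT => r; exact: cst_continuous.
  - rewrite (_ : _ \o _ = EFin \o (fun=> 0)); first exact: integrable_constant.
    by apply/funext => r /=; rewrite mxE.
  - under eq_Rintegral do rewrite mxE.
    by rewrite Rintegral_cst// mul0r addr0 !mxE.
  - exact: root_gap_open (gpsi r rt).
  - rewrite mxE sub0r normrN normrM (gtr0_norm k0) ler_pM2l//.
    by have := driftD_bound j ltr01 (gpsi r rt); rewrite divr1.
have {}H := H s st.
have Z0 : euclidean_norm (Num.sqrt k *: x - l *: x) <= (q1 + l) * euclidean_norm x.
  have ql0 : 0 <= q1 + l by rewrite addr_ge0// ltW.
  have ZE : euclidean_norm ((q1 + l) *: x) = (q1 + l) * euclidean_norm x.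
    rewrite /euclidean_norm (eq_bigr (fun i => (q1 + l) ^+ 2 * x 0 i ^+ 2)).
      by rewrite -mulr_sumr sqrtrM ?sqr_ge0// sqrtr_sqr ger0_norm.
    by move=> j _; rewrite mxE exprMn.
  rewrite -ZE -scalerBl; apply: le_euclidean_norm => j; rewrite !mxE !normrM.
  rewrite ler_wpM2r// (ger0_norm ql0); apply: le_trans (ler_normB _ _) _.
  by rewrite ger0_norm ?sqrtr_ge0// (gtr0_norm l0) lerD2r.
have X0 := coord_le_euclidean_norm (X k s - psi s) i.
have psi0 : `|psi s 0 i| <= l * euclidean_norm x + Mb.
  rewrite !mxE; apply: le_trans (ler_normD _ _) _; apply: lerD; last exact: bM.
  by rewrite normrM gtr0_norm// ler_pM2l// coord_le_euclidean_norm.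
have kL : 2 * (k * (2 * N%:R)) * N%:R * t <= 2 * (q1 ^+ 2 * (2 * N%:R)) * N%:R * t.
  by rewrite !ler_wpM2r ?ler_wpM2l ?ler_wpM2r ?mulr_ge0.
rewrite -(subrK (psi s 0 i) (X k s 0 i)); apply: le_trans (ler_normD _ _) _.
have XE : (X k s - psi s) 0 i = X k s 0 i - psi s 0 i by rewrite !mxE.
move: X0; rewrite XE /L; lra.
Qed.

(** The range of [k] is split at [sqrt k = q1]: above it the comparison with [psi] applies, below it
    every term is bounded separately. *)
Lemma besselB0_pathwise : exists C, forall k s, 2^-1 <= k -> 0 <= s <= t ->
  Num.sqrt k * euclidean_norm (abs_last (X k s) - Num.sqrt k *: phi s - W s)
  <= C.
Proof.
have [e1 e10 gphi1] := odeD_gap hphi t0.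
have [e2 e20 lphi2] : exists2 e2, 0 < e2 &
    forall (i : 'I_N) (s : R), 0 <= s <= t -> i.+1 = N -> e2 <= phi s 0 i.
  pose f (i : 'I_N) s : R := if i.+1 == N then phi s 0 i else 1.
  have cf i : {within `[0, t], continuous f i}.
    rewrite /f; case: (i.+1 == N); first exact: (odeD_continuous hphi).
    by apply: continuous_subspaceT => r; exact: cst_continuous.
  have f0 i (s : R) : 0 <= s <= t -> 0 < f i s.
    move=> /andP[s0 _]; rewrite /f; case: eqP => // iN.
    exact: (odeD_last_gt0 hphi (interior_chamberB_last xB iN)).
  have [e2 e20 He] := within_continuous_lower t0 cf f0.
  by exists e2 => // i s st iN; have := He i s st; rewrite /f iN eqxx.
pose e := Num.min e1 e2.
have e0 : 0 < e by rewrite lt_min e10.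
have [ee1 ee2] : e <= e1 /\ e <= e2 by rewrite !ge_min !lexx orbT.
have gphi s : 0 <= s <= t -> root_gap e (phi s).
  by move=> st i j ij; apply: le_trans (gphi1 s st i j ij); rewrite lerD2r.
have lphi (i : 'I_N) (s : R) : 0 <= s <= t -> i.+1 = N -> e <= phi s 0 i.
  by move=> st iN; apply: le_trans ee2 _; exact: lphi2.
have [M M0 WM] := within_continuous_bounded t0 cW.
have [Mp Mp0 phiM] := within_continuous_bounded t0 (odeD_continuous hphi (t := t)).
have [q1 q10 q1E] : exists2 q1, 0 <= q1 & forall q, q1 <= q -> 4 * M <= q * e.
  exists (4 * M / e); first by rewrite divr_ge0 ?mulr_ge0// ltW.
  by move=> q; rewrite ler_pdivrMr.
have [L L0 XL] := besselD_bounded q10.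
exists (Num.max (2 * (N%:R * (16 * M ^+ 2 / e ^+ 3)) * N%:R * t)
  (q1 * (N%:R * (L + q1 * Mp + M)))) => k s k2 st.
rewrite le_max; have [kq|kq] := leP q1 (Num.sqrt k).
  apply/orP; left; apply: besselB0_large => //; exact: q1E.
apply/orP; right; have B0 : 0 <= L + q1 * Mp + M.
  by rewrite !addr_ge0 ?mulr_ge0 ?(ltW Mp0) ?(ltW M0).
apply: ler_pM; rewrite ?sqrtr_ge0 ?euclidean_norm_ge0 ?(ltW kq)//.
apply: euclidean_norm_le_sum => // i.
have -> : (abs_last (X k s) - Num.sqrt k *: phi s - W s) 0 i =
  abs_last (X k s) 0 i - Num.sqrt k * phi s 0 i - W s 0 i by rewrite !mxE.
apply: le_trans (ler_normB _ _) _; apply: lerD; last exact: WM.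
apply: le_trans (ler_normB _ _) _; apply: lerD.
  by rewrite norm_abs_last XL// ltW.
rewrite normrM ger0_norm ?sqrtr_ge0//; apply: ler_pM; rewrite ?sqrtr_ge0 ?(ltW kq)//.
exact: phiM.
Qed.
End Pathwise.

(** * From a single path to the almost sure statement *)

Unset Implicit Arguments.
Set Strict Implicit.
Theorem theorem5p2 (d : measure_display) (T : measurableType d) (R : realType)
    (P : probability T R) (N : nat) (hN : (2 <= N)%N)
    (x : 'rV[R]_N) (hx : (@chamberB R N)° x)
    (B : R -> T -> 'rV[R]_N) (hB : brownian_motion P B)
    (XD : R -> R -> T -> 'rV[R]_N)
    (hXD : besselD_family P B (fun k => Num.sqrt k *: x) XD)
    (phi : R -> 'rV[R]_N) (hphi : odeD_solution x phi)
    (W : R -> T -> 'rV[R]_N) (hW : limit_process P B phi W)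
    (t : R) (ht : 0 < t) :
  {ae P, forall w,
    (ereal_sup [set r : \bar R | exists s k : R,
       [/\ 0 <= s, s <= t, 2^-1 <= k &
         r = (Num.sqrt k * euclidean_norm
               (besselB0 XD k s w - Num.sqrt k *: phi s - W s w))%:E]]%R
     < +oo)%E}.
Proof.
have [_ _ _ _ cB] := hB; have [_ sdeX] := hXD; have [_ sdeW] := hW.
(* The three almost sure events depend on neither [k] nor [s]; on their intersection the pathwise
   bound covers the whole supremum. *)
apply: filterS3 cB sdeX sdeW.
move=> w cb hX sW.
have [C HC] := besselB0_pathwise hphi hx cb hX sW (ltW ht).
apply: (@le_lt_trans _ _ C%:E); last exact: ltry.
apply: ge_ereal_sup => _ [s [k [s0 st k2 ->]]].
by rewrite lee_fin; apply: HC; rewrite ?s0.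
Qed.
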